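(* Let $D$ be a Noetherian integral domain. The following statements are equivalent: (1) $D$ is Artinian; (2) every torsion-free $D$-module is weakly-morphic; (3) every divisible $D$-module is weakly-morphic.
   Context: All modules are unital. A $D$-module $M$ is divisible if $Ma=M$ for each $0\neq a\in D$; it is torsion-free if $ma=0$ implies $a=0$ or $m=0$ for all $m\in M$, $a\in D$. A $D$-module $M$ is weakly-morphic if $M/Ma\cong \{m\in M: ma=0\}$ as $D$-modules for every $a\in D$. *)

(* Defs.v *)
From HB Require Import structures.
From mathcomp Require Import all_boot all_order all_algebra.
From mathcomp Require Import boolp classical_sets.

Set Implicit Arguments.
Unset Strict Implicit.
Unset Printing Implicit Defensive.

Import GRing.Theory.
Local Open Scope ring_scope.
Local Open Scope quotient_scope.

Section Submodule.
Variables (R : pzRingType) (M : lmodType R) (N : submodClosed M).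

Record submod := Submod { submod_val : M; _ : submod_val \in N }.

HB.instance Definition _ := [isSub for submod_val].
HB.instance Definition _ := [Choice of submod by <:].
HB.instance Definition _ := [SubChoice_isSubLmodule of submod by <:].

End Submodule.

Section QuotientModule.
Variables (R : pzRingType) (M : lmodType R) (N : submodClosed M).

(* [submodClosed] is declared over semimodules and hence does not inherit from
   [zmodClosed], which [Quotient.quot] requires; over a ring the closure under
   opposites is automatic. *)
Definition submod_pred : {pred M} := N.

Fact submod_pred_zmod_closed : zmod_closed submod_pred.
Proof. exact: GRing.submod_closedB (submodClosedP N). Qed.

HB.instance Definition _ := GRing.isZmodClosed.Build M submod_pred
  submod_pred_zmod_closed.

Definition lmod_quot : Type := Quotient.quot submod_pred.

HB.instance Definition _ := GRing.Zmodule.on lmod_quot.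
HB.instance Definition _ : EqQuotient M (Quotient.equiv submod_pred) lmod_quot :=
  EqQuotient.on lmod_quot.
HB.instance Definition _ :
    isZmodQuotient M (Quotient.equiv submod_pred) 0 -%R +%R lmod_quot :=
  ZmodQuotient.on lmod_quot.

Definition quot_scale (a : R) (x : lmod_quot) : lmod_quot :=
  \pi_lmod_quot (a *: repr x).

Lemma pi_scale a (m : M) :
  \pi_lmod_quot (a *: m) = quot_scale a (\pi_lmod_quot m).
Proof.
have mE (u v : M) : (\pi_lmod_quot u == \pi_lmod_quot v) = (u - v \in N).
  exact: eqmodE.
by apply/eqP; rewrite mE -scalerBr rpredZ // -mE reprK eqxx.
Qed.

Fact quot_scaleA a b x :
  quot_scale a (quot_scale b x) = quot_scale (a * b) x.
Proof. by rewrite -[x]reprK -(pi_scale b (repr x)) -!pi_scale scalerA. Qed.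

Fact quot_scale1 : left_id 1 quot_scale.
Proof. by move=> x; rewrite -[x]reprK -pi_scale scale1r. Qed.

Fact quot_scaleDr : right_distributive quot_scale +%R.
Proof.
move=> a x y; rewrite -[x]reprK -[y]reprK -pi_addr -!pi_scale -pi_addr.
by rewrite scalerDr.
Qed.

Fact quot_scaleDl x : {morph quot_scale^~ x : a b / a + b}.
Proof. by move=> a b; rewrite -[x]reprK -!pi_scale -pi_addr scalerDl. Qed.

HB.instance Definition _ := GRing.Zmodule_isLmodule.Build R lmod_quot
  quot_scaleA quot_scale1 quot_scaleDr quot_scaleDl.

End QuotientModule.

Definition lmod_iso (R : pzRingType) (U V : lmodType R) : Prop :=
  exists f : {linear U -> V}, bijective f.

Section ScaledModule.
Variables (R : comPzRingType) (M : lmodType R) (a : R).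

(* The submodule Ma; scalars are written on the left, R being commutative. *)
Definition multiples : {pred M} := fun m => `[< exists n : M, m = a *: n >].

Fact multiples_submod_closed : subsemimod_closed multiples.
Proof.
split; first split.
- by apply/asboolP; exists 0; rewrite scaler0.
- move=> _ _ /asboolP[u ->] /asboolP[v ->]; apply/asboolP.
  by exists (u + v); rewrite scalerDr.
- move=> b _ /asboolP[u ->]; apply/asboolP.
  by exists (b *: u); rewrite !scalerA mulrC.
Qed.

HB.instance Definition _ := GRing.isSubmodClosed.Build R M multiples
  multiples_submod_closed.

Definition annihilated : {pred M} := fun m => a *: m == 0.

Fact annihilated_submod_closed : subsemimod_closed annihilated.
Proof.
split; first split; rewrite /annihilated.
- by rewrite unfold_in scaler0.
- move=> u v; rewrite !unfold_in => /eqP u0 /eqP v0.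
  by rewrite scalerDr u0 v0 addr0.
- move=> b u; rewrite !unfold_in => /eqP u0.
  by rewrite scalerA mulrC -scalerA u0 scaler0.
Qed.

HB.instance Definition _ := GRing.isSubmodClosed.Build R M annihilated
  annihilated_submod_closed.

End ScaledModule.

Arguments multiples {R} M a.
Arguments annihilated {R} M a.

Definition weakly_morphic (R : comPzRingType) (M : lmodType R) : Prop :=
  forall a : R, lmod_iso (lmod_quot (multiples M a)) (submod (annihilated M a)).

Definition divisible (D : idomainType) (M : lmodType D) : Prop :=
  forall a : D, a != 0 -> forall m : M, m \in multiples M a.

Definition torsion_free (D : idomainType) (M : lmodType D) : Prop :=
  forall (m : M) (a : D), a *: m = 0 -> a = 0 \/ m = 0.

(* The library's [idealr] covers only proper ideals with a boolean membership
   test; here the unit ideal is allowed and membership is propositional. *)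
Definition is_ideal (R : comPzRingType) (I : set R) : Prop :=
  [/\ I 0, forall x y, I x -> I y -> I (x + y)
    & forall r x, I x -> I (r * x)].

Local Open Scope classical_set_scope.

Definition noetherian (R : comPzRingType) : Prop :=
  forall I : nat -> set R, (forall n, is_ideal (I n)) ->
    (forall n, I n `<=` I n.+1) ->
    exists n, forall k, (n <= k)%N -> I k = I n.

Definition artinian (R : comPzRingType) : Prop :=
  forall I : nat -> set R, (forall n, is_ideal (I n)) ->
    (forall n, I n.+1 `<=` I n) ->
    exists n, forall k, (n <= k)%N -> I k = I n.

(* Main.v *)
Require Import Defs.
From mathcomp Require Import all_boot all_order all_algebra.
From HB Require Import structures.
From mathcomp Require Import boolp classical_sets.

(** Each of the three conditions says that [D] is a field.  A domain is Artinian
    iff it is a field: the chain of the ideals [(a ^ n)] of a nonzero [a] can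
    only become stationary if [a] is a unit, and a field has no ideals besides
    [0] and itself ([artinian_unit], [unit_artinian]).

    For the module conditions, let [a] be nonzero.  A divisible module has
    [M / Ma = 0], and a torsion-free one has no nonzero element killed by [a];
    so for a module with one of the two properties, being weakly morphic amounts
    to having the other one as well
    ([divisible_torsion_free_weakly_morphic], [torsion_free_weakly_morphic],
    [divisible_weakly_morphic]).  Over a field every module has both.
    Conversely, [D] is a torsion-free module over itself, and if it is divisible
    then [D] is a field; and [K / D], for [K] the field of fractions, is a
    divisible module in which [1 / a] is killed by [a], so if it is torsion-free
    then [1 / a] lies in [D] for every nonzero [a], and again [D] is a field. *)

Set Implicit Arguments.
Unset Strict Implicit.
Unset Printing Implicit Defensive.

Import GRing.Theory.
Local Open Scope ring_scope.
Local Open Scope quotient_scope.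

(** * Quotients and submodules that are trivial or everything *)

Section Quotients.
Variables (R : pzRingType) (M : lmodType R) (N : submodClosed M).

Lemma pi_eq (u v : M) :
  (\pi_(lmod_quot N) u == \pi_(lmod_quot N) v) = (u - v \in N).
Proof. exact: eqmodE. Qed.

Lemma pi_eq0 (u : M) : (\pi_(lmod_quot N) u == 0) = (u \in N).
Proof. by rewrite -(@pi_zeror _ _ _ _ _ (lmod_quot N)) pi_eq subr0. Qed.

Lemma pi_scaler (a : R) (u : M) :
  \pi_(lmod_quot N) (a *: u) = a *: \pi_(lmod_quot N) u.
Proof. exact: pi_scale. Qed.

Lemma lmod_quot_eq0 : (forall m, m \in N) -> forall x : lmod_quot N, x = 0.
Proof. by move=> NT x; rewrite -[x]reprK; apply/eqP; rewrite pi_eq0. Qed.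

Lemma mem_lmod_quot_eq0 :
  (forall x : lmod_quot N, x = 0) -> forall m, m \in N.
Proof. by move=> Q0 m; rewrite -pi_eq0; apply/eqP; apply: Q0. Qed.

(** Choosing representatives is in general not linear; it is when the classes
    are singletons. *)
Lemma repr_linear :
  (forall m, m \in N -> m = 0) -> linear (repr : lmod_quot N -> M).
Proof.
move=> N0 a x y; apply/eqP; rewrite -subr_eq0; apply/eqP/N0.
by rewrite -pi_eq pi_addr pi_scaler !reprK.
Qed.

End Quotients.

Section IsoLemmas.
Variable R : pzRingType.

Lemma lmod_iso_eq0 (U V : lmodType R) :
  (forall u : U, u = 0) -> (forall v : V, v = 0) -> lmod_iso U V.
Proof.
move=> U0 V0; exists (\0 : {linear U -> V}).
by exists (fun=> 0) => x; rewrite ?[RHS]U0 ?[RHS]V0.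
Qed.

Lemma lmod_iso_eq0l (U V : lmodType R) :
  lmod_iso U V -> (forall v : V, v = 0) -> forall u : U, u = 0.
Proof. by case=> f [g fK _] V0 u; rewrite -[u]fK [f u]V0 -(raddf0 f) fK. Qed.

Lemma lmod_iso_eq0r (U V : lmodType R) :
  lmod_iso U V -> (forall u : U, u = 0) -> forall v : V, v = 0.
Proof. by case=> f [g _ gK] U0 v; rewrite -[v]gK [g v]U0 raddf0. Qed.

(** Both sides are copies of [M].  This is the case of the scalar [0], where
    weak morphicity holds for every module. *)
Lemma lmod_quot_submod_iso (M : lmodType R) (N P : submodClosed M) :
    (forall m, m \in N -> m = 0) -> (forall m, m \in P) ->
  lmod_iso (lmod_quot N) (submod P).
Proof.
move=> N0 PT; pose f (x : lmod_quot N) := Submod (PT (repr x)).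
have f_lin : linear f by move=> a x y; apply: val_inj; apply: repr_linear.
pose fL := GRing.isLinear.Build R (lmod_quot N) (submod P) *:%R f f_lin.
exists (HB.pack_for {linear lmod_quot N -> submod P} f fL).
exists (fun y => \pi_(lmod_quot N) (val y)) => x.
  exact: reprK.
apply: val_inj; apply/eqP; rewrite -subr_eq0; apply/eqP/N0.
by rewrite -pi_eq reprK.
Qed.

End IsoLemmas.

(** * Weakly morphic modules over a domain *)

Section WeaklyMorphic.
Variables (D : idomainType) (M : lmodType D).

Lemma mem_annihilated (a : D) (m : M) :
  (m \in annihilated M a) = (a *: m == 0).
Proof. by rewrite unfold_in. Qed.

Lemma torsion_freeP :
  (forall a : D, a != 0 -> forall x : submod (annihilated M a), x = 0) <->
  torsion_free M.
Proof.
split=> [ann0 m a am0 | tfM a a0 [m mP]].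
  case: (eqVneq a 0) => [|a0]; [by left | right].
  have mP : m \in annihilated M a by rewrite mem_annihilated am0.
  by have /(congr1 val) /= := ann0 a a0 (Submod mP).
apply: val_inj => /=; move: mP; rewrite mem_annihilated => /eqP /tfM[] // aE.
by rewrite aE eqxx in a0.
Qed.

Lemma divisible_torsion_free_weakly_morphic :
  divisible M -> torsion_free M -> weakly_morphic M.
Proof.
move=> divM /torsion_freeP tfM a; have [->|a0] := eqVneq a 0.
  apply: lmod_quot_submod_iso => m.
    by move=> /asboolP[n ->]; rewrite scale0r.
  by rewrite mem_annihilated scale0r.
apply: lmod_iso_eq0 (tfM a a0).
exact: lmod_quot_eq0 (divM a a0).
Qed.

Lemma torsion_free_weakly_morphic :
  torsion_free M -> weakly_morphic M -> divisible M.
Proof.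
move=> /torsion_freeP tfM wmM a a0; apply: mem_lmod_quot_eq0.
exact: lmod_iso_eq0l (wmM a) (tfM a a0).
Qed.

Lemma divisible_weakly_morphic :
  divisible M -> weakly_morphic M -> torsion_free M.
Proof.
move=> divM wmM; apply/torsion_freeP => a a0.
apply: lmod_iso_eq0r (wmM a) _.
exact: lmod_quot_eq0 (divM a a0).
Qed.

Hypothesis D_field : forall a : D, a != 0 -> a \is a GRing.unit.

Lemma unit_divisible : divisible M.
Proof.
move=> a a0 m; apply/asboolP; exists (a^-1 *: m).
by rewrite scalerA divrr ?scale1r ?D_field.
Qed.

Lemma unit_torsion_free : torsion_free M.
Proof.
move=> m a am0; case: (eqVneq a 0) => [|a0]; [by left | right].
by rewrite -[m]scale1r -(mulVr (D_field a0)) -scalerA am0 scaler0.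
Qed.

Lemma unit_weakly_morphic : weakly_morphic M.
Proof.
exact: divisible_torsion_free_weakly_morphic unit_divisible unit_torsion_free.
Qed.

End WeaklyMorphic.

(** * The regular module *)

Lemma regular_torsion_free (D : idomainType) : torsion_free D^o.
Proof. by move=> m a /eqP; rewrite mulf_eq0 => /orP[] /eqP; [left | right]. Qed.

Lemma regular_divisible_unit (D : idomainType) :
  divisible D^o -> forall a : D, a != 0 -> a \is a GRing.unit.
Proof.
move=> divD a a0; have /asboolP[b ab1] := divD a a0 1.
by apply/unitrPr; exists b; rewrite ab1.
Qed.

(** * The field of fractions modulo the domain *)

Local Notation "x %:F" := (tofrac x) : ring_scope.

Section FractionModule.
Variable D : idomainType.

(** A copy of the field of fractions, to carry the scalar action of [D]. *)
Definition frac_lmod : Type := {fraction D}.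
HB.instance Definition _ := GRing.Zmodule.on frac_lmod.

Definition frac_scale (a : D) (x : frac_lmod) : frac_lmod :=
  (a%:F * (x : {fraction D}) : {fraction D}).

Fact frac_scaleA a b x : frac_scale a (frac_scale b x) = frac_scale (a * b) x.
Proof. by rewrite /frac_scale rmorphM mulrA. Qed.

Fact frac_scale1 : left_id 1 frac_scale.
Proof. by move=> x; rewrite /frac_scale rmorph1 mul1r. Qed.

Fact frac_scaleDr : right_distributive frac_scale +%R.
Proof. by move=> a x y; apply: mulrDr. Qed.

Fact frac_scaleDl x : {morph frac_scale^~ x : a b / a + b}.
Proof. by move=> a b; rewrite /frac_scale rmorphD; apply: mulrDl. Qed.

HB.instance Definition _ := GRing.Zmodule_isLmodule.Build D frac_lmod
  frac_scaleA frac_scale1 frac_scaleDr frac_scaleDl.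

Definition integral_frac : {pred frac_lmod} :=
  fun x => `[< exists b : D, x = b%:F >].

Fact integral_frac_submod_closed : subsemimod_closed integral_frac.
Proof.
split; first split.
- by apply/asboolP; exists 0; rewrite rmorph0.
- move=> _ _ /asboolP[b ->] /asboolP[c ->]; apply/asboolP.
  by exists (b + c); rewrite rmorphD.
- move=> a _ /asboolP[b ->]; apply/asboolP.
  by exists (a * b); rewrite rmorphM.
Qed.

HB.instance Definition _ := GRing.isSubmodClosed.Build D frac_lmod
  integral_frac integral_frac_submod_closed.

Lemma frac_quot_divisible : divisible (lmod_quot integral_frac).
Proof.
move=> a a0 x; apply/asboolP.
exists (\pi_(lmod_quot integral_frac) ((a%:F)^-1 * (repr x : {fraction D}))).
rewrite -pi_scaler -{1}[x]reprK; congr (\pi _).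
by rewrite /GRing.scale /= /frac_scale mulVKf // tofrac_eq0.
Qed.

Lemma frac_quot_torsion_free_unit :
  torsion_free (lmod_quot integral_frac) ->
  forall a : D, a != 0 -> a \is a GRing.unit.
Proof.
move=> tf a a0; have aF0 : a%:F != 0 by rewrite tofrac_eq0.
pose x : frac_lmod := (a%:F)^-1.
have ax0 : a *: \pi_(lmod_quot integral_frac) x = 0.
  apply/eqP; rewrite -pi_scaler pi_eq0; apply/asboolP; exists 1.
  by rewrite rmorph1 -(divff aF0).
case: (tf _ _ ax0) => [aE|/eqP]; first by rewrite aE eqxx in a0.
rewrite pi_eq0 => /asboolP[b xE]; apply/unitrPr; exists b.
by apply/eqP; rewrite -tofrac_eq tofracM tofrac1 -[b%:F]xE divff.
Qed.

End FractionModule.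

(** * Artinian domains *)

Section Artinian.
Variable D : idomainType.

Lemma artinian_unit :
  artinian D -> forall a : D, a != 0 -> a \is a GRing.unit.
Proof.
move=> artD a a0; pose I n : set D := [set x | exists r, x = r * a ^+ n]%classic.
have idI n : is_ideal (I n).
  split=> [|x y|r x]; first by exists 0; rewrite mul0r.
    by move=> [r ->] [s ->]; exists (r + s); rewrite mulrDl.
  by move=> [s ->]; exists (r * s); rewrite mulrA.
have [n In] : exists n, forall k, (n <= k)%N -> I k = I n.
  by apply: artD idI _ => n x [r ->]; exists (r * a); rewrite exprS mulrA.
have : I n.+1 (a ^+ n) by rewrite In //; exists 1; rewrite mul1r.
case=> r anE; apply/unitrPr; exists r; rewrite mulrC.
by apply: (mulIf (expf_neq0 n a0)); rewrite mul1r -mulrA -exprS.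
Qed.

(** If every term of the chain contains [1], it is constant; otherwise it
    vanishes from the first term missing [1] on. *)
Lemma unit_artinian :
  (forall a : D, a != 0 -> a \is a GRing.unit) -> artinian D.
Proof.
move=> Dunit I idI Idec.
have ideal1 n x : I n x -> x != 0 -> I n 1.
  by case: (idI n) => _ _ IM Ix x0; rewrite -(mulVr (Dunit x x0)); apply: IM.
have Imono n k : (n <= k)%N -> (I k `<=` I n)%classic.
  elim: k => [|k IHk]; first by rewrite leqn0 => /eqP->.
  by rewrite leq_eqVlt => /predU1P[->//|/IHk Ikn] x /Idec /Ikn.
have [[n nI1]|I1] := pselect (exists n, ~ I n 1).
  exists n => k nk; apply/seteqP; split; first exact: Imono.
  move=> x Inx; have [->|x0] := eqVneq x 0; first by case: (idI k).
  by case: nI1; apply: ideal1 Inx x0.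
exists 0%N => k _; apply/seteqP; split; first exact: Imono.
move=> x _; case: (idI k) => _ _ IM; rewrite -[x]mulr1; apply: IM.
by apply: contrapT => nI1; apply: I1; exists k.
Qed.

End Artinian.

Theorem theorem3 (D : idomainType) (noethD : noetherian D) :
  (artinian D <->
     (forall M : lmodType D, torsion_free M -> weakly_morphic M)) /\
  (artinian D <->
     (forall M : lmodType D, divisible M -> weakly_morphic M)).
Proof.
split; split=> [artD M _|wm].
- exact: unit_weakly_morphic (artinian_unit artD).
- apply/unit_artinian/regular_divisible_unit.
  have tfD := @regular_torsion_free D.
  exact: torsion_free_weakly_morphic tfD (wm _ tfD).
- exact: unit_weakly_morphic (artinian_unit artD).
- apply/unit_artinian/frac_quot_torsion_free_unit.
  have divKD := @frac_quot_divisible D.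
  exact: divisible_weakly_morphic divKD (wm _ divKD).
Qed.
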